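(* Let $X$ be a compact metric space and $f:X\to X$ be a homeomorphism. Let $x\in X$ be a periodic point of $f$ and $p\in\beta\mathbb{N}$. Then $$(f^p\circ (f^{-1})^p)(x)=((f^{-1})^p\circ f^p)(x)=x.$$
   Context: $\mathbb{N}$ is the set of non-negative integers and $\beta\mathbb{N}$ is the set of all ultrafilters on $\mathbb{N}$ (principal ones included). For $p\in\beta\mathbb{N}$ and a sequence $(x_n)_n$ in $X$, $x=p\text{-}\lim_n x_n$ means that $\{n\in\mathbb{N}: x_n\in V\}\in p$ for every neighborhood $V$ of $x$; this limit exists and is unique in a compact metric space. For a map $g:X\to X$, the $p$-iterate of $g$ is $g^p:X\to X$, $g^p(x)=p\text{-}\lim_n g^n(x)$. A point $x$ is periodic if $f^n(x)=x$ for some $n\geq 1$. *)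

(* Defs.v *)
From HB Require Import structures.
From mathcomp Require Import all_boot all_order all_algebra.
From mathcomp Require Import all_classical all_reals all_analysis.

Set Implicit Arguments.
Unset Strict Implicit.
Unset Printing Implicit Defensive.

Local Open Scope classical_set_scope.

(* [u n @[n --> p] --> y] unfolds to: for every neighborhood V of y, the set
   [set n | V (u n)] belongs to p. The default value [u 0] of [xget] avoids
   requiring a pointed X; by [plimP] it plays no role when p is an ultrafilter
   and X is compact Hausdorff. *)
Definition plim (X : topologicalType) (p : set_system nat) (u : nat -> X) : X :=
  xget (u 0%N) [set y | u n @[n --> p] --> y].

Definition piterate (X : topologicalType) (p : set_system nat) (g : X -> X)
  (x : X) : X := plim p (fun n => iter n g x).

Definition periodic_point (X : Type) (f : X -> X) (x : X) : Prop :=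
  exists n : nat, (1 <= n)%N /\ iter n f x = x.

Definition homeomorphism_with_inverse (X Y : topologicalType) (f : X -> Y)
    (finv : Y -> X) : Prop :=
  [/\ cancel f finv, cancel finv f, continuous f & continuous finv].

Lemma fmap_ultra (T U : Type) (f : T -> U) (F : set_system T) :
  UltraFilter F -> UltraFilter (f @ F).
Proof.
move=> FU; split=> [|G GF sFG]; first exact: fmap_proper_filter.
apply/seteqP; split=> [A GA|//].
have [//|FnA] := in_ultra_setVsetC (f @^-1` A) FU.
have /sFG GnA : (f @ F) (~` A) by [].
by have /filter_ex [? []] : G (A `&` ~` A) by exact: filterI.
Qed.

Lemma plimP (X : topologicalType) (p : set_system nat) (u : nat -> X) (y : X) :
  hausdorff_space X -> compact [set: X] -> UltraFilter p ->
  u n @[n --> p] --> y <-> plim p u = y.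
Proof.
move=> hX cX pU; have upU := fmap_ultra u pU.
have ucvg : u n @[n --> p] --> plim p u.
  move: cX; rewrite compact_ultra => /(_ _ upU filterT) [z [_ uz]].
  exact: (xgetPex (u 0%N) (ex_intro _ z uz)).
by split=> [uy|<- //]; exact: (cvg_unique hX ucvg uy).
Qed.

(* Main.v *)
Require Import Defs.
From mathcomp Require Import all_boot all_order all_algebra.
From mathcomp Require Import all_classical all_reals all_analysis.

(** An ultrafilter contains exactly one class of any finite partition of the
natural numbers; apply this to the residue classes modulo a period [N] of [x],
and let [r < N] be the residue class that belongs to [p]
([ultra_mem_residue_class]). If [g] has [N] as a period at [y], the sequence
[iter n g y] is constant on that class, with value [iter r g y], so its
[p]-limit is [iter r g y] ([piterate_periodic]). The remainder [r] depends on
[N] and [p] only. Since [N] is a period of both [f] and its inverse at every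
point of the orbit of [x], both [p]-iterates act on this orbit as [r]-fold
iterates, of [f] and of its inverse, and these cancel. *)

Local Open Scope classical_set_scope.

Lemma iter_modn_period (T : Type) (g : T -> T) (N n : nat) (y : T) :
  iter N g y = y -> iter n g y = iter (n %% N)%N g y.
Proof.
move=> gN; rewrite {1}(divn_eq n N) addnC iterD iterM; congr iter.
exact: iter_fix.
Qed.

Lemma cancel_iter (T : Type) (f g : T -> T) (n : nat) :
  cancel f g -> cancel (iter n f) (iter n g).
Proof. by move=> fK; elim: n => // n IHn y; rewrite iterSr /= fK IHn. Qed.

(** Only finitely many remainders are possible, and an ultrafilter that
contains a finite union of sets contains one of them; the induction on [k]
splits off the largest remainder still allowed. *)
Lemma ultra_mem_residue_class (p : set_system nat) (N : nat) :
  UltraFilter p -> (0 < N)%N -> exists r, p [set n | n %% N = r]%N.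
Proof.
move=> pU N_gt0.
suff residue_lt k : p [set n | n %% N < k]%N -> exists r, p [set n | n %% N = r]%N.
  by apply: (residue_lt N); apply: filterS filterT => n _; rewrite /= ltn_mod.
elim: k => [/filter_ex [n]//|k IHk pk].
have [pr|pr] := in_ultra_setVsetC [set n | n %% N = k]%N pU; first by exists k.
apply: IHk; apply: filterS (filterI pk pr) => n /= [].
by rewrite ltnS leq_eqVlt => /orP[/eqP|].
Qed.

Lemma plim_eventually_const (X : topologicalType) (p : set_system nat)
    (u : nat -> X) (y : X) :
  hausdorff_space X -> ProperFilter p -> p [set n | u n = y] -> plim p u = y.
Proof.
move=> hX pF puy.
have uy : u n @[n --> p] --> y by exact: cvg_near_cst.
have u_plim : u n @[n --> p] --> plim p u.
  by apply: (@xgetPex _ (u 0%N) [set z | u n @[n --> p] --> z]); exists y.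
exact: (cvg_unique hX u_plim uy).
Qed.

Lemma piterate_periodic (X : topologicalType) (p : set_system nat)
    (g : X -> X) (N r : nat) (y : X) :
  hausdorff_space X -> ProperFilter p -> p [set n | n %% N = r]%N ->
  iter N g y = y -> piterate p g y = iter r g y.
Proof.
move=> hX pF pr gN; apply: plim_eventually_const => //.
by apply: filterS pr => n /= <-; exact: iter_modn_period.
Qed.

(** The hypotheses are symmetric in [f] and [g], so that each half of the
theorem is an instance. The inner [p]-iterate moves [x] to [iter r g x], whose
period under [f] has to be checked before evaluating the outer one. *)
Lemma piterate_cancel (X : topologicalType) (p : set_system nat)
    (f g : X -> X) (N : nat) (x : X) :
  hausdorff_space X -> UltraFilter p -> cancel f g -> cancel g f ->
  (0 < N)%N -> iter N f x = x -> piterate p f (piterate p g x) = x.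
Proof.
move=> hX pU fK gK N_gt0 fN.
have gN : iter N g x = x by rewrite -{1}fN; exact: cancel_iter.
have [r pr] := ultra_mem_residue_class p N pU N_gt0.
rewrite (piterate_periodic X p g N r x) //.
rewrite (piterate_periodic X p f N r) //; first exact: cancel_iter.
have -> : iter r g x = iter N g (iter r g x) by rewrite -iterD addnC iterD gN.
by rewrite cancel_iter // -iterD addnC iterD gN.
Qed.

Theorem lemma4p1 (R : realType) (X : metricType R) (compactX : compact [set: X])
    (f finv : X -> X) (homeo_f : homeomorphism_with_inverse f finv)
    (x : X) (periodic_x : periodic_point f x)
    (p : set_system nat) (ultra_p : UltraFilter p) :
  (piterate p f \o piterate p finv) x = x /\
  (piterate p finv \o piterate p f) x = x.
Proof.
have [fK finvK _ _] := homeo_f; have [N [N_gt0 fN]] := periodic_x.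
have finvN : iter N finv x = x by rewrite -{1}fN; exact: cancel_iter.
have hX := @metric_hausdorff R X.
by split; apply: (piterate_cancel X p _ _ N).
Qed.
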